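(* Let $\theta\in(0,1)$. The Neumann-Dirichlet algorithm ND$_1$ converges if and only if $$\rho_{\mathrm{ND}_1}:=\max_{1\le i\le n}\Big|1-\theta\Big(1-\nu^{-1}\frac{\sigma_i\gamma+\beta_i\coth(b_i)}{\big(\sigma_i+d_i\coth(a_i)\big)\big(\omega_i+\sigma_i\coth(b_i)\big)}\Big)\Big|<1.$$
   Context: Let $A\in\mathbb{R}^{n\times n}$ be symmetric with eigenvalues $d_1,\dots,d_n$, and let $\nu>0$, $\gamma\ge 0$, $T>0$, $0<\alpha<T$. Set $\Omega_1=(0,\alpha)$, $\Omega_2=(\alpha,T)$, $\sigma_i=\sqrt{d_i^2+\nu^{-1}}$, $\omega_i=\nu^{-1}\gamma+d_i$, $\beta_i=1-\gamma d_i$, $a_i=\sigma_i\alpha$, $b_i=\sigma_i(T-\alpha)$. Algorithm ND$_1$ (error equations): for each $i$, given an initial guess $f_i^0\in\mathbb{R}$, for $k=1,2,\dots$: (1) solve $\dot z_{2,i}^k+d_iz_{2,i}^k-\nu^{-1}\mu_{2,i}^k=0$, $\dot\mu_{2,i}^k-z_{2,i}^k-d_i\mu_{2,i}^k=0$ in $\Omega_2$ with $z_{2,i}^k(\alpha)=f_i^{k-1}$, $\mu_{2,i}^k(T)+\gamma z_{2,i}^k(T)=0$; (2) solve $\dot z_{1,i}^k+d_iz_{1,i}^k-\nu^{-1}\mu_{1,i}^k=0$, $\dot\mu_{1,i}^k-z_{1,i}^k-d_i\mu_{1,i}^k=0$ in $\Omega_1$ with $z_{1,i}^k(0)=0$,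 $\dot\mu_{1,i}^k(\alpha)=\dot\mu_{2,i}^k(\alpha)$; (3) set $f_i^k=(1-\theta)f_i^{k-1}+\theta z_{1,i}^k(\alpha)$. Assume all subdomain problems are uniquely solvable for every datum, so that the algorithm is well defined. The algorithm converges if $f_i^k\to 0$ as $k\to\infty$ for every $i$ and every initial guess $(f_1^0,\dots,f_n^0)\in\mathbb{R}^n$. *)

(* Defs.v *)
From HB Require Import structures.
From mathcomp Require Import all_boot all_order all_algebra.
From mathcomp Require Import all_classical all_reals all_analysis.

Set Implicit Arguments.
Unset Strict Implicit.
Unset Printing Implicit Defensive.

Import Order.TTheory GRing.Theory Num.Theory.
Import numFieldNormedType.Exports.

Local Open Scope classical_set_scope.
Local Open Scope ring_scope.

Definition coth (R : realType) (x : R) : R :=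
  (expR x + expR (- x)) / (expR x - expR (- x)).

(* One-sided derivatives: the solutions on ]0, alpha[ and ]alpha, T[ are only
   meaningful on one side of the interface alpha. *)
Definition has_right_derivative (R : realType) (f : R -> R) (x l : R) : Prop :=
  h^-1 * (f (x + h) - f x) @[h --> 0^'+] --> l.

Definition has_left_derivative (R : realType) (f : R -> R) (x l : R) : Prop :=
  h^-1 * (f (x + h) - f x) @[h --> 0^'-] --> l.

(* Classical solutions: differentiable in the open interval and continuous up
   to its endpoints, so that boundary values make sense. *)
Definition error_system (R : realType) (nu d a b : R) (z mu : R -> R) : Prop :=
  [/\ derivable_oo_LRcontinuous z a b,
      derivable_oo_LRcontinuous mu a b &
      forall t : R, t \in `]a, b[ ->
        derive1 z t + d * z t - nu^-1 * mu t = 0 /\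
        derive1 mu t - z t - d * mu t = 0].

Definition subproblem2 (R : realType) (nu gamma alpha T d f : R)
    (z mu : R -> R) : Prop :=
  [/\ error_system nu d alpha T z mu, z alpha = f & mu T + gamma * z T = 0].

Definition subproblem1 (R : realType) (nu alpha d g : R)
    (z mu : R -> R) : Prop :=
  [/\ error_system nu d 0 alpha z mu, z 0 = 0 & has_left_derivative mu alpha g].

(* Solutions are represented by total functions on R, hence uniqueness is
   agreement on the closed interval [a, b]. *)
Definition uniquely_solvable (R : realType) (a b : R)
    (P : (R -> R) -> (R -> R) -> Prop) : Prop :=
  (exists z mu : R -> R, P z mu) /\
  (forall z mu z' mu' : R -> R, P z mu -> P z' mu' ->
    forall t : R, t \in `[a, b] -> z t = z' t /\ mu t = mu' t).

Definition well_defined_ND1 (R : realType) (nu gamma alpha T : R)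
    (n : nat) (d : 'I_n -> R) : Prop :=
  forall i : 'I_n,
    (forall f : R,
      uniquely_solvable alpha T (subproblem2 nu gamma alpha T (d i) f)) /\
    (forall g : R,
      uniquely_solvable 0 alpha (subproblem1 nu alpha (d i) g)).

(* [fold] and [fnew] are the interface values f_i^{k-1} and f_i^k. *)
Definition ND1_step (R : realType) (nu gamma alpha T theta d : R)
    (fold fnew : R) : Prop :=
  exists z1 mu1 z2 mu2 : R -> R, exists g : R,
    [/\ subproblem2 nu gamma alpha T d fold z2 mu2,
        has_right_derivative mu2 alpha g,
        subproblem1 nu alpha d g z1 mu1 &
        fnew = (1 - theta) * fold + theta * z1 alpha].

Definition ND1_iterates (R : realType) (nu gamma alpha T theta : R)
    (n : nat) (d : 'I_n -> R) (f0 : 'I_n -> R) (f : nat -> 'I_n -> R) : Prop :=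
  f 0%N = f0 /\
  forall (k : nat) (i : 'I_n),
    ND1_step nu gamma alpha T theta (d i) (f k i) (f k.+1 i).

(* Under [well_defined_ND1] each initial guess has exactly one sequence of
   iterates, so the quantification over [f] is neither vacuous nor ambiguous. *)
Definition ND1_converges (R : realType) (nu gamma alpha T theta : R)
    (n : nat) (d : 'I_n -> R) : Prop :=
  forall (f0 : 'I_n -> R) (f : nat -> 'I_n -> R),
    ND1_iterates nu gamma alpha T theta d f0 f ->
    forall i : 'I_n, f k i @[k --> \oo] --> (0 : R).

Definition ND1_factor (R : realType) (nu gamma alpha T theta d : R) : R :=
  let sigma := Num.sqrt (d ^+ 2 + nu^-1) in
  let omega := nu^-1 * gamma + d in
  let beta := 1 - gamma * d in
  let a := sigma * alpha in
  let b := sigma * (T - alpha) in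
  1 - theta * (1 - nu^-1 *
    ((sigma * gamma + beta * coth b) /
     ((sigma + d * coth a) * (omega + sigma * coth b)))).

(* The entries are nonnegative, so starting the maximum at 0 is harmless for
   n >= 1. *)
Definition rho_ND1 (R : realType) (nu gamma alpha T theta : R)
    (n : nat) (d : 'I_n -> R) : R :=
  \big[Num.max/0]_(i < n) `|ND1_factor nu gamma alpha T theta (d i)|.

(* Main.v *)
(** If [s ^+ 2 = d ^+ 2 + nu^-1], then along any solution of the error system
[(s - d) z + nu^-1 mu] is a multiple of [t |-> expR (s t)]; for [s = sigma] and
[s = - sigma] this determines [z] and [mu], and the boundary conditions turn one
step of the iteration into multiplication of the interface value by
[ND1_factor].  The powers of a real [r] tend to [0] iff [`|r| < 1]. *)

Require Import Defs.
From HB Require Import structures.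
From mathcomp Require Import all_boot all_order all_algebra.
From mathcomp Require Import all_classical all_reals all_analysis.
From mathcomp Require Import ring lra.

Import Order.TTheory GRing.Theory Num.Theory.
Import numFieldNormedType.Exports.

Local Open Scope ring_scope.

(** * Exponential modes of the error system *)

Lemma linear_combination_LRcontinuous {R : realType} {f g : R -> R} {a b : R}
    (c e : R) :
  derivable_oo_LRcontinuous f a b -> derivable_oo_LRcontinuous g a b ->
  derivable_oo_LRcontinuous (fun t => c * f t + e * g t) a b.
Proof.
move=> [df fa fb] [dg ga gb]; split.
- move=> t tab; apply: derivableD; apply: derivableM.
  + exact: derivable_cst.
  + exact: df.
  + exact: derivable_cst.
  + exact: dg.
- by apply: cvgD; apply: cvgM => //; exact: cvg_cst.
- by apply: cvgD; apply: cvgM => //; exact: cvg_cst.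
Qed.

(** Integrating factor: [expR (- k * (s - a)) * w s] has zero derivative inside the interval and is
    continuous up to [a], so the mean value theorem makes it constant. *)
Lemma linear_ode_sol {R : realType} {w : R -> R} {a b k : R} : a < b ->
  derivable_oo_LRcontinuous w a b ->
  (forall t, t \in `]a, b[ -> derive1 w t = k * w t) ->
  forall t, t \in `[a, b] -> w t = w a * expR (k * (t - a)).
Proof.
move=> ab wab wE t; rewrite in_itv/= => /andP[at_ tb].
pose G := fun s => expR (- k * (s - a)) * w s.
have Gder s : s \in `]a, t[ -> is_derive s 1 G ((fun=> 0) s).
  rewrite in_itv/= => /andP[as_ st].
  have sab : s \in `]a, b[ by rewrite in_itv/= as_ (lt_le_trans st).
  have dw : is_derive s 1 w (k * w s).
    by rewrite -wE// derive1E; apply: derivableP; case: wab => + _ _; apply.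
  apply: is_derive_eq.
  rewrite /GRing.scale/=; ring.
have Gcont : {within `[a, t], continuous G}%classic.
  apply: (@continuous_subspaceW _ _ _ `[a, b]%classic).
    by apply: subset_itvl; rewrite bnd_simp.
  move=> x; apply: cvgM; last exact: (derivable_oo_LRcontinuous_within wab).
  apply: continuous_subspaceT => y.
  apply/differentiable_continuous/derivable1_diffP.
  exact: ex_derive.
have [s _] := MVT_segment at_ Gder Gcont.
rewrite mul0r => /eqP; rewrite subr_eq0 /G subrr mulr0 expR0 mul1r => /eqP <-.
by rewrite mulrAC -expRD mulNr addNr expR0 mul1r.
Qed.

(** The row [(s - d, nu^-1)] is a left eigenvector, with eigenvalue [s], of the matrix of the
    system. The sign of [s] is left free so that both eigenvalues are covered. *)
Lemma error_system_mode {R : realType} {nu d a b s : R} {z mu : R -> R} :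
  a < b -> s ^+ 2 = d ^+ 2 + nu^-1 -> error_system nu d a b z mu ->
  forall t, t \in `[a, b] ->
    (s - d) * z t + nu^-1 * mu t =
    ((s - d) * z a + nu^-1 * mu a) * expR (s * (t - a)).
Proof.
move=> ab sE [hz hmu sys].
apply: (linear_ode_sol ab (linear_combination_LRcontinuous (s - d) nu^-1 hz hmu)).
move=> t tab.
have dz : is_derive t 1 z (derive1 z t).
  by rewrite derive1E; apply: derivableP; case: hz => + _ _; apply.
have dmu : is_derive t 1 mu (derive1 mu t).
  by rewrite derive1E; apply: derivableP; case: hmu => + _ _; apply.
rewrite derive1E derive_val.
have [e1 e2] := sys t tab.
have -> : derive1 z t = nu^-1 * mu t - d * z t by lra.
have -> : derive1 mu t = z t + d * mu t by lra.
rewrite /GRing.scale/=.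
have -> : nu^-1 = s ^+ 2 - d ^+ 2 by lra.
ring.
Qed.

(** The differential equations are assumed only in the open interval. The closed form of [mu] is
    smooth on all of [R], so its derivative also gives the one-sided slopes at the endpoints. *)
Lemma error_system_mu_extension {R : realType} {nu d a b s : R}
    {z mu : R -> R} :
  a < b -> 0 < nu -> 0 < s -> s ^+ 2 = d ^+ 2 + nu^-1 ->
  error_system nu d a b z mu ->
  exists F : R -> R, forall t, t \in `[a, b] ->
    mu t = F t /\ is_derive t 1 F (z t + d * mu t).
Proof.
move=> ab nu0 s0 sE sys.
have sN0 : s != 0 by rewrite gt_eqF.
have nuN0 : nu != 0 by rewrite gt_eqF.
have sNE : (- s) ^+ 2 = d ^+ 2 + nu^-1 by rewrite sqrrN.
pose p := (s - d) * z a + nu^-1 * mu a.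
pose q := (- s - d) * z a + nu^-1 * mu a.
(* Weighting the modes of [s] and [- s] by [s + d] and [s - d] cancels [z] and leaves
   [2 * s * nu^-1 * mu]. *)
exists (fun t => nu / (2 * s) * ((s + d) * (p * expR (s * (t - a))) +
                                 (s - d) * (q * expR (- s * (t - a))))).
move=> t tab.
have := error_system_mode ab sE sys t tab; rewrite -/p => pt.
have := error_system_mode ab sNE sys t tab; rewrite -/q => qt.
split.
  by rewrite -pt -qt; field; rewrite nuN0.
apply: is_derive_eq.
rewrite /GRing.scale/=.
transitivity (nu / 2 * ((s + d) * (p * expR (s * (t - a))) -
                        (s - d) * (q * expR (- s * (t - a))))).
  by field.
rewrite -pt -qt.
have sE' : s * s = d * d + nu^-1 by rewrite -!expr2.
transitivity (nu * ((s * s - d * d) * z t) + d * mu t); last first.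
  by rewrite sE' addrAC subrr add0r mulrA divff// mul1r.
by field.
Qed.

(** * One-sided derivatives at the interface *)

Lemma has_right_derivative_eq_in {R : realType} {f F : R -> R} {a b l : R} :
  a < b -> (forall t, t \in `[a, b] -> f t = F t) -> is_derive a 1 F l ->
  has_right_derivative f a l.
Proof.
move=> ab fF [dF <-].
have := cvg_dnbhs_at_right dF.
apply: cvg_trans; apply: near_eq_cvg.
near=> h.
have h0 : 0 < h by near: h; exact: nbhs_right_gt.
have hb : h < b - a by near: h; apply: nbhs_right_lt; rewrite subr_gt0.
rewrite /GRing.scale/= mulr1 (addrC h a) !fF// in_itv/=; apply/andP; split; lra.
Unshelve. all: by end_near. Qed.

Lemma has_left_derivative_eq_in {R : realType} {f F : R -> R} {a b l : R} :
  a < b -> (forall t, t \in `[a, b] -> f t = F t) -> is_derive b 1 F l ->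
  has_left_derivative f b l.
Proof.
move=> ab fF [dF <-].
have := cvg_dnbhs_at_left dF.
apply: cvg_trans; apply: near_eq_cvg.
near=> h.
have h0 : h < 0 by near: h; exact: nbhs_left_lt.
have hb : a - b < h by near: h; apply: nbhs_left_gt; rewrite subr_lt0.
rewrite /GRing.scale/= mulr1 (addrC h b) !fF// in_itv/=; apply/andP; split; lra.
Unshelve. all: by end_near. Qed.

(** * Interface value and slope in each subproblem *)

(** By the second equation the left-hand side is the slope of [mu] at [alpha]: this is the
    Dirichlet-to-Neumann map of the right subdomain. *)
Lemma subproblem2_slope {R : realType}
    {nu gamma alpha T d f s : R} {z mu : R -> R} :
  0 < nu -> 0 <= gamma -> alpha < T -> 0 < s -> s ^+ 2 = d ^+ 2 + nu^-1 ->
  subproblem2 nu gamma alpha T d f z mu ->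
  z alpha + d * mu alpha =
  f * (s * ((s * gamma + (1 - gamma * d) * coth (s * (T - alpha))) /
            (nu^-1 * gamma + d + s * coth (s * (T - alpha))))).
Proof.
move=> nu0 gamma0 aT s0 sE [sys zf bT].
have nuN0 : nu != 0 by rewrite gt_eqF.
have sNE : (- s) ^+ 2 = d ^+ 2 + nu^-1 by rewrite sqrrN.
have Tin : T \in `[alpha, T] by rewrite in_itv/= lexx ltW.
have := error_system_mode aT sE sys T Tin.
have := error_system_mode aT sNE sys T Tin.
rewrite /coth mulNr expRN zf.
have : 1 < expR (s * (T - alpha)) by rewrite expR_gt1 mulr_gt0// subr_gt0.
move: (expR _) => e e1.
have ->: mu T = - (gamma * z T) by lra.
move: (z T) (mu alpha) => y m qT pT.
have nui0 : 0 < nu^-1 by rewrite invr_gt0.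
have dlt : 0 < s + d.
  rewrite ltNge; apply/negP => h; have : s ^+ 2 <= d ^+ 2 by nra.
  by rewrite sE; lra.
have i0 : 0 < e^-1 by rewrite invr_gt0 (lt_trans ltr01).
have i1 : e^-1 < 1 by rewrite invf_lt1 // (lt_trans ltr01).
have ei0 : e - e^-1 != 0 by rewrite gt_eqF // subr_gt0 (lt_trans i1).
have so : 0 < s + (nu^-1 * gamma + d).
  have := mulr_ge0 (ltW nui0) gamma0; lra.
have nE : nu^-1 = s * s - d * d by rewrite -!expr2 sE; ring.
move: (e^-1) i0 i1 ei0 qT pT => i i0 i1 ei0 qT pT.
(* This is the denominator of the claimed quotient multiplied by [e - i]; it is positive because
   [s + (nu^-1 * gamma + d) > 0] and [e > i > 0]. *)
have E0 : (s + (nu^-1 * gamma + d)) * e + (s - (nu^-1 * gamma + d)) * i != 0.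
  have -> : (s + (nu^-1 * gamma + d)) * e + (s - (nu^-1 * gamma + d)) * i =
    (s + (nu^-1 * gamma + d)) * (e - i) + 2 * s * i by ring.
  rewrite gt_eqF // addr_gt0 ?mulr_gt0 ?ltr0n // subr_gt0.
  exact: lt_trans e1.
have -> : (s * gamma + (1 - gamma * d) * ((e + i) / (e - i))) /
    (nu^-1 * gamma + d + s * ((e + i) / (e - i))) =
    (s * gamma * (e - i) + (1 - gamma * d) * (e + i)) /
    ((s + (nu^-1 * gamma + d)) * e + (s - (nu^-1 * gamma + d)) * i).
  field.
  rewrite nuN0 ei0 andbT /=; have := mulf_neq0 nuN0 E0.
  by congr (_ != 0); field.
apply: (mulIf E0); rewrite -!mulrA mulVf // mulr1.
apply: (@mulfI _ nu^-1); first by rewrite gt_eqF.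
apply/eqP; rewrite -subr_eq0; apply/eqP.
(* Eliminating [y = z T] between the two modes leaves a linear equation for
   [m = mu alpha]. *)
transitivity (d * (((s - d) * f + nu^-1 * m) * e * (s + (nu^-1 * gamma + d)) +
                   ((- s - d) * f + nu^-1 * m) * i * (s - (nu^-1 * gamma + d)))).
  by rewrite nE; ring.
(* With omega = [nu^-1 * gamma + d], the condition at [T] turns the two modes there into
   [(s - omega) * y] and [- (s + omega) * y], so the bracket vanishes. *)
by rewrite -pT -qT nE; ring.
Qed.

(** The slope is expressed through [z alpha], and not conversely, because [s + d * coth (s * alpha)]
    can vanish when [d < 0]. *)
Lemma subproblem1_slope {R : realType} {nu alpha d g s : R} {z mu : R -> R} :
  0 < nu -> 0 < alpha -> 0 < s -> s ^+ 2 = d ^+ 2 + nu^-1 ->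
  subproblem1 nu alpha d g z mu ->
  g = nu * s * (s + d * coth (s * alpha)) * z alpha.
Proof.
move=> nu0 a0 s0 sE [sys z0 gL].
have nuN0 : nu != 0 by rewrite gt_eqF.
have sNE : (- s) ^+ 2 = d ^+ 2 + nu^-1 by rewrite sqrrN.
have ain : alpha \in `[0, alpha] by rewrite in_itv/= lexx ltW.
have [F FE] := error_system_mu_extension a0 nu0 s0 sE sys.
have gE : g = z alpha + d * mu alpha.
  have gL' : has_left_derivative mu alpha (z alpha + d * mu alpha).
    by apply: has_left_derivative_eq_in a0 _ (FE _ ain).2 => t /FE[].
  exact: cvg_unique _ gL gL'.
have := error_system_mode a0 sE sys alpha ain.
have := error_system_mode a0 sNE sys alpha ain.
rewrite gE /coth !subr0 mulNr expRN z0 !mulr0 !add0r.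
have : 1 < expR (s * alpha) by rewrite expR_gt1 mulr_gt0.
move: (expR _) => e e1 qT pT.
have i0 : 0 < e^-1 by rewrite invr_gt0 (lt_trans ltr01).
have i1 : e^-1 < 1 by rewrite invf_lt1 // (lt_trans ltr01).
have ei0 : e - e^-1 != 0 by rewrite gt_eqF // subr_gt0 (lt_trans i1).
move: (e^-1) i0 i1 ei0 qT pT => i i0 i1 ei0 qT pT.
have nE : nu^-1 = s * s - d * d by rewrite -!expr2 sE; ring.
(* Since [z 0 = 0], both modes start from the same value, so their sum and difference at [alpha] are
   in the ratio of [e + i] to [e - i]. *)
have H : (nu^-1 * mu alpha - d * z alpha) * (e - i) = s * z alpha * (e + i).
  apply: (@mulfI _ 2); first by rewrite pnatr_eq0.
  transitivity (((s - d) * z alpha + nu^-1 * mu alpha) * (e - i) +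
                ((- s - d) * z alpha + nu^-1 * mu alpha) * (e - i)); first by ring.
  have -> : 2 * (s * z alpha * (e + i)) =
    (((s - d) * z alpha + nu^-1 * mu alpha) -
     ((- s - d) * z alpha + nu^-1 * mu alpha)) * (e + i) by ring.
  by rewrite qT pT; ring.
apply: (mulIf ei0); apply: (@mulfI _ nu^-1); first by rewrite invr_eq0.
transitivity (s * z alpha * (s * (e - i) + d * (e + i))); last by field; rewrite nuN0 ei0.
transitivity (d * ((nu^-1 * mu alpha - d * z alpha) * (e - i)) +
  (nu^-1 + d * d) * z alpha * (e - i)); first by ring.
by rewrite H nE; ring.
Qed.

(** * One step as multiplication by the factor *)

Lemma ND1_stepE {R : realType} {nu gamma alpha T theta d x y : R} :
  0 < nu -> 0 <= gamma -> 0 < alpha -> alpha < T ->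
  uniquely_solvable 0 alpha (subproblem1 nu alpha d 1) ->
  ND1_step nu gamma alpha T theta d x y ->
  y = ND1_factor nu gamma alpha T theta d * x.
Proof.
move=> nu0 gamma0 a0 aT [[z [mu sol]] _] [z1 [mu1 [z2 [mu2 [g [s2 gR s1 ->]]]]]].
rewrite /ND1_factor; set s := Num.sqrt _.
have nuN0 : nu != 0 by rewrite gt_eqF.
have s20 : 0 < d ^+ 2 + nu^-1 by rewrite ltr_wpDl ?sqr_ge0 ?invr_gt0.
have s0 : 0 < s by rewrite sqrtr_gt0.
have sN0 : s != 0 by rewrite gt_eqF.
have sE : s ^+ 2 = d ^+ 2 + nu^-1 by rewrite sqr_sqrtr // ltW.
have sys2 : error_system nu d alpha T z2 mu2 by case: s2.
have [F FE] := error_system_mu_extension aT nu0 s0 sE sys2.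
have ain : alpha \in `[alpha, T] by rewrite in_itv/= lexx ltW.
have gE : g = z2 alpha + d * mu2 alpha.
  have gR' : has_right_derivative mu2 alpha (z2 alpha + d * mu2 alpha).
    by apply: has_right_derivative_eq_in aT _ (FE _ ain).2 => t /FE[].
  exact: cvg_unique _ gR gR'.
(* Solvability for the datum [1] forces this factor to be nonzero. *)
have D0 : s + d * coth (s * alpha) != 0.
  apply/eqP => D0; have /eqP := subproblem1_slope nu0 a0 s0 sE sol.
  by rewrite D0 mulr0 mul0r oner_eq0.
have := subproblem1_slope nu0 a0 s0 sE s1.
rewrite gE (subproblem2_slope nu0 gamma0 aT s0 sE s2).
set Q := _ / _ => h.
(* Equating the two slopes cancels the common factor [s]; the [nu] of the left subdomain becomes the
   [nu^-1] of the factor. *)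
have -> : z1 alpha = nu^-1 * (Q / (s + d * coth (s * alpha))) * x.
  apply: (mulfI (_ : nu * s * (s + d * coth (s * alpha)) != 0)).
    by rewrite !mulf_neq0.
  rewrite -h; field.
  by rewrite nuN0 D0.
by rewrite [in RHS]invfM mulrCA mulrC; rewrite /Q; ring.
Qed.

(** Convergence speaks only of sequences that are iterates, so bounding the factors from it requires
    iterates to be constructed. *)
Lemma ND1_step_exists {R : realType} {nu gamma alpha T theta d : R} (x : R) :
  0 < nu -> 0 <= gamma -> 0 < alpha -> alpha < T ->
  (forall f, uniquely_solvable alpha T (subproblem2 nu gamma alpha T d f)) ->
  (forall g, uniquely_solvable 0 alpha (subproblem1 nu alpha d g)) ->
  ND1_step nu gamma alpha T theta d x (ND1_factor nu gamma alpha T theta d * x).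
Proof.
move=> nu0 gamma0 a0 aT wd2 wd1.
have [[z2 [mu2 s2]] _] := wd2 x.
have s20 : 0 < d ^+ 2 + nu^-1 by rewrite ltr_wpDl ?sqr_ge0 ?invr_gt0.
have sys2 : error_system nu d alpha T z2 mu2 by case: s2.
have s0 : 0 < Num.sqrt (d ^+ 2 + nu^-1) by rewrite sqrtr_gt0.
have [F FE] := error_system_mu_extension aT nu0 s0 (sqr_sqrtr (ltW s20)) sys2.
have ain : alpha \in `[alpha, T] by rewrite in_itv/= lexx ltW.
have gR : has_right_derivative mu2 alpha (z2 alpha + d * mu2 alpha).
  by apply: has_right_derivative_eq_in aT _ (FE _ ain).2 => t /FE[].
have [[z1 [mu1 s1]] _] := wd1 (z2 alpha + d * mu2 alpha).
have st : ND1_step nu gamma alpha T theta d x ((1 - theta) * x + theta * z1 alpha).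
  by exists z1, mu1, z2, mu2, (z2 alpha + d * mu2 alpha).
by rewrite -(ND1_stepE nu0 gamma0 a0 aT (wd1 1) st).
Qed.

Lemma cvg_exprn0_norm_lt1 {R : realType} {r : R} :
  (r ^+ k @[k --> \oo] --> (0 : R))%classic -> `|r| < 1.
Proof.
move=> r0; rewrite ltNge; apply/negP => r1.
have /cvgrPdist_lt /(_ 1 ltr01) [k _ /(_ k (leqnn k))] := r0.
by rewrite /= sub0r normrN normrX ltNge exprn_ege1.
Qed.

Theorem theorem3 (R : realType) (n : nat) (hn : (0 < n)%N)
    (A : 'M[R]_n) (hA : A^T = A)
    (d : 'I_n -> R) (hd : char_poly A = \prod_(i < n) ('X - (d i)%:P))
    (nu gamma T alpha : R) (hnu : 0 < nu) (hgamma : 0 <= gamma)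
    (hT : 0 < T) (halpha0 : 0 < alpha) (halphaT : alpha < T)
    (hwd : well_defined_ND1 nu gamma alpha T d)
    (theta : R) (htheta0 : 0 < theta) (htheta1 : theta < 1) :
  ND1_converges nu gamma alpha T theta d <->
  rho_ND1 nu gamma alpha T theta d < 1.
Proof.
pose r i := ND1_factor nu gamma alpha T theta (d i).
split=> [conv | /bigmax_ltP[_ rlt] f0 f [f00 step] i].
- apply/bigmax_ltP; split=> // i _; apply: cvg_exprn0_norm_lt1.
  (* The initial guess equal to 1 in every component exposes the powers of all the factors at
     once. *)
  apply: (conv (fun=> 1) (fun k i => r i ^+ k)); split=> [|k j].
    by apply/funext => j; rewrite expr0.
  have [wd2 wd1] := hwd j.
  by rewrite exprS; exact: ND1_step_exists.
- have fE k : f k i = r i ^+ k * f 0%N i.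
    elim: k => [|k IHk]; first by rewrite expr0 mul1r.
    rewrite (ND1_stepE hnu hgamma halpha0 halphaT ((hwd i).2 1) (step k i)) IHk.
    by rewrite exprS mulrA.
  under eq_fun do rewrite fE.
  by rewrite -(mul0r (f 0%N i)); apply: cvgMl; apply: cvg_expr; exact: rlt.
Qed.
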